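(* Let $1<\beta<\infty$ and let $0\le\tilde\delta(\cdot)<\delta(\cdot)<1$. Let $s(\cdot),p(\cdot)\in\mathcal{P}^{\log}(\mathbb{R}^n)$ be defined by $\delta(\cdot)/n=1/\beta-1/s(\cdot)$ and $\tilde\delta(\cdot)/n=1/\beta-1/p(\cdot)$, respectively. If $w$ is a weight with $w^{-1}\in A_{n/(\delta(\cdot)-\tilde\delta(\cdot)),\infty}$, then there is a constant $C>0$ (independent of $f$) such that $$\left\|f^\sharp_{\tilde\delta(\cdot)}/w\right\|_\infty\le C\left\|f^\sharp_{\delta(\cdot)}/w\right\|_{n/(\delta(\cdot)-\tilde\delta(\cdot))}.$$
   Context: Here $f$ is a locally integrable function on $\mathbb{R}^n$; a weight is a locally integrable function with values in $(0,\infty)$ a.e.; $m_Bf=\frac1{|B|}\int_Bf$. For a measurable $p:\mathbb{R}^n\to[1,\infty)$ let $p^-=\operatorname{ess\,inf}p$, $p^+=\operatorname{ess\,sup}p$; $p\in\mathcal{P}(\mathbb{R}^n)$ if $1<p^-\le p^+<\infty$. $\|f\|_{p(\cdot)}=\inf\{\lambda>0:\int_{\mathbb{R}^n}|f(x)/\lambda|^{p(x)}dx\le1\}$, and $p'(\cdot)$ is the pointwise conjugate exponent. $p\in\mathcal{P}^{\log}(\mathbb{R}^n)$ if $p\in\mathcal{P}(\mathbb{R}^n)$ and for some $C$: $|p(x)-p(y)|\le\frac{C}{\log(e+1/|x-y|)}$ for all $x,y\in\mathbb{R}^n$, and $|p(x)-p(y)|\le\frac{C}{\log(e+|x|)}$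 whenever $|y|\ge|x|$. For $q(\cdot)\in\mathcal{P}(\mathbb{R}^n)$ with $\eta(x)/n=1/\beta-1/q(x)\ge0$, the $\eta(\cdot)$-sharp maximal operator is $$f^\sharp_{\eta(\cdot)}(x)=\sup_{B\ni x}\frac{1}{|B|^{1/\beta}\|\chi_B\|_{q'(\cdot)}}\int_B|f-m_Bf|,$$ the supremum being over all balls $B$ containing $x$. Thus $f^\sharp_{\delta(\cdot)}$ uses $q=s$ and $f^\sharp_{\tilde\delta(\cdot)}$ uses $q=p$. For an exponent $q(\cdot)$, a weight $u$ is in $A_{q(\cdot),\infty}$ if there is $C>0$ with $\|u\chi_B\|_\infty\|u^{-1}\chi_B\|_{q'(\cdot)}\le C\|\chi_B\|_{q'(\cdot)}$ for every ball $B$. *)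

(* Defs.v *)
From HB Require Import structures.
From mathcomp Require Import all_boot all_order all_algebra.
From mathcomp Require Import all_classical all_reals all_analysis.
From mathcomp Require Import ess_sup_inf.

Set Implicit Arguments.
Unset Strict Implicit.
Unset Printing Implicit Defensive.

Import Order.TTheory GRing.Theory Num.Theory.
Import numFieldNormedType.Exports.

Local Open Scope classical_set_scope.
Local Open Scope ring_scope.

Section lebesgue_measure_n.
Variable R : realType.

Definition tcons n (z : n.-tuple R * R) : n.+1.-tuple R := [tuple of z.2 :: z.1].

Lemma measurable_tcons n : measurable_fun [set: n.-tuple R * R] (@tcons n).
Proof. by apply: measurable_cons; [exact: measurable_snd | exact: measurable_fst]. Qed.

Definition measure_tcons n (m : {measure set (n.-tuple R) -> \bar R}) :
    set (n.+1.-tuple R) -> \bar R :=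
  pushforward (m \x @lebesgue_measure R)%E (@tcons n).

HB.instance Definition _ n (m : {measure set (n.-tuple R) -> \bar R}) :=
  Measure.copy (measure_tcons m)
    (measure_function_pushforward__canonical__measure_function_Measure
       (m \x @lebesgue_measure R)%E (@measurable_tcons n)).

(* Lebesgue measure on the Borel (product) sigma-algebra of R^n *)
Fixpoint borel_measure n : {measure set (n.-tuple R) -> \bar R} :=
  match n return {measure set (n.-tuple R) -> \bar R} with
  | 0 => dirac [tuple]
  | m.+1 => measure_tcons (borel_measure m)
  end.

End lebesgue_measure_n.

(* The points of R^n are n-tuples; its sigma-algebra is that of the Lebesgue
   measurable sets, i.e. the completion of the Borel one, obtained as the
   Caratheodory sigma-algebra of the outer measure of borel_measure. *)
Definition Rn (R : realType) (n : nat) : Type :=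
  caratheodory_type ((borel_measure R n)^*)%mu.

HB.instance Definition _ (R : realType) (n : nat) :=
  Measurable.copy (Rn R n) (caratheodory_type ((borel_measure R n)^*)%mu).

Definition leb (R : realType) (n : nat) : set (Rn R n) -> \bar R :=
  @completed_measure_extension _ _ R (borel_measure R n).

HB.instance Definition _ (R : realType) (n : nat) := Measure.on (@leb R n).

Section variable_exponent.
Variables (R : realType) (n : nat).
Local Notation Rn := (Rn R n).
Local Notation mu := (@leb R n).
Implicit Types (p q : Rn -> R) (f w u : Rn -> R) (x y c : Rn).

Definition enorm_diff x y : R :=
  Num.sqrt (\sum_(i < n) (tnth x i - tnth y i) ^+ 2).

Definition enorm x : R := Num.sqrt (\sum_(i < n) tnth x i ^+ 2).

Definition eball c (r : R) : set Rn := [set y | enorm_diff y c < r].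

Definition locally_integrable_n f :=
  measurable_fun [set: Rn] f /\
  forall c (r : R), mu.-integrable (eball c r) (EFin \o f).

Definition weight w :=
  locally_integrable_n w /\ {ae mu, forall x, 0 < w x}.

Definition average (B : set Rn) f : R :=
  (\int[mu]_(y in B) f y) / fine (mu B).

Definition exponent_P p :=
  [/\ measurable_fun [set: Rn] p,
      forall x, 1 <= p x,
      (1 < ess_inf mu (EFin \o p))%E &
      (ess_sup mu (EFin \o p) < +oo)%E].

(* For x = y the first right-hand side is C, since 0^-1 = 0; this is harmless
   because the left-hand side vanishes. *)
Definition log_Hoelder p :=
  exists C : R,
    (forall x y, `|p x - p y| <= C / ln (expR 1 + (enorm_diff x y)^-1)) /\
    (forall x y, enorm x <= enorm y ->
       `|p x - p y| <= C / ln (expR 1 + enorm x)).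

Definition exponent_Plog p := exponent_P p /\ log_Hoelder p.

(* The values where p = 1 (conjugate exponent +oo) are sent to 0; for the
   exponents in use they form a null set. *)
Definition conj_exp p : Rn -> R := fun x => fine (hoelder_conjugate (p x)%:E).

Local Open Scope ereal_scope.

(* Luxemburg norm; +oo when no l is admissible. *)
Definition vnorm p (F : Rn -> \bar R) : \bar R :=
  ereal_inf [set l%:E | l in
    [set l : R | (0 < l)%R /\ \int[mu]_x (`|F x| / l%:E) `^ (p x) <= 1]].

Definition chi (B : set Rn) : Rn -> \bar R := fun x => (\1_B x)%:E.

(* The sharp maximal operator of order eta, where eta x / n = 1/beta - 1/q x. *)
Definition sharp_maximal (beta : R) q f x : \bar R :=
  ereal_sup [set e | exists c (r : R), let B := eball c r in
    [/\ (0 < r)%R, B x &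
        e = (\int[mu]_(y in B) `|f y - average B f|%:E) /
            (mu B `^ beta^-1 * vnorm (conj_exp q) (chi B))]].

Definition A_infty q u :=
  weight u /\
  exists2 C : R, (0 < C)%R & forall c (r : R), (0 < r)%R ->
    let B := eball c r in
    Lnorm mu +oo (fun x => (u x)%:E * chi B x) *
      vnorm (conj_exp q) (fun x => (u x)^-1%:E * chi B x)
    <= C%:E * vnorm (conj_exp q) (chi B).

End variable_exponent.

(* Main.v *)
(* Write a_r = 1 - 1/r = 1/r' and let 1/q = 1/p - 1/s, that is
   q = n / (delta - tdelta).  Fix a ball B and let k be the quantity attached
   to B in the sharp maximal function of f of order delta.  That function is at
   least k on B, so Hoelder's inequality for the Luxemburg norm gives
   k |B| <= 2 |f^#_delta / w|_q |w chi_B|_{q'}, and the A_{q,oo} condition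
   turns this into k |B| |chi_B / w|_oo <= C |f^#_delta / w|_q |chi_B|_{q'}.
   It remains to prove |chi_B|_{s'} |chi_B|_{q'} <= C |B| |chi_B|_{p'}.
   Since a_s + a_q = 1 + a_p, this follows from |chi_B|_{r'} ~ |B|^(a_r(z)) for
   r = s, q, p and a point z depending on B only.  If |B| < 1, take z to be the
   center of B.  If |B| >= 1, take z farther from the origin than all of B, so
   that the decay condition compares a_r(x) with a_r(z) when x is far from the
   origin; the other points of B lie in a cube of measure at most |B|^al / 2,
   where al = 1 - 1/beta bounds every a_r from below. *)

Require Import Defs.
From mathcomp Require Import all_boot all_order all_algebra.
From mathcomp Require Import all_classical all_reals all_analysis.
From mathcomp Require Import measurable_realfun ess_sup_inf ring lra.

Set Implicit Arguments.
Unset Strict Implicit.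
Unset Printing Implicit Defensive.

Import Order.TTheory GRing.Theory Num.Theory.
Import numFieldNormedType.Exports.

Local Open Scope ring_scope.

(** * Lebesgue measure of cubes and balls *)

Section lebesgue_measure_of_cubes.
Local Open Scope classical_set_scope.
Variable R : realType.

Lemma measurable_Rn_borel n (A : set (n.-tuple R)) :
  measurable A -> measurable (A : set (Rn R n)).
Proof. exact: caratheodory_measurable_mu_ext. Qed.

Lemma leb_borel n (A : set (n.-tuple R)) :
  measurable A -> @leb R n A = borel_measure R n A.
Proof. exact: measurable_mu_extE. Qed.

(** Cubes replace balls in measure computations: for a product measure their volume follows by
    induction on the dimension, and two-sided bounds for balls suffice. *)
Definition cube n (c : n.-tuple R) (rho : R) : set (n.-tuple R) :=
  [set y | forall i, `|tnth y i - tnth c i| <= rho].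

Lemma measurable_cube n (c : n.-tuple R) rho : measurable (cube c rho).
Proof.
rewrite (_ : cube c rho = \bigcap_(i : 'I_n)
    ((fun y => tnth y i) @^-1` `[tnth c i - rho, tnth c i + rho])).
  apply: fin_bigcap_measurable => // i _; rewrite -[_ @^-1` _]setTI.
  by apply: measurable_tnth => //; exact: measurable_itv.
apply/seteqP; split=> y.
  by move=> yc i _ /=; rewrite in_itv /= -ler_distlC distrC; exact: yc.
move=> yc i; have := yc i I.
by rewrite /= in_itv /= -ler_distlC distrC.
Qed.

Lemma borel_measure_cube n (c : n.-tuple R) rho : 0 < rho ->
  borel_measure R n (cube c rho) = ((rho *+ 2) ^+ n)%:E.
Proof.
move=> rho0; elim: n c => [|n IH] c.
  rewrite /= diracE mem_set ?expr0// => -[] //.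
rewrite /= /measure_tcons /pushforward.
rewrite (_ : _ @^-1` _ = cube [tuple of behead c] rho `*`
    `[tnth c ord0 - rho, tnth c ord0 + rho]).
  rewrite product_measure1E//; last exact: measurable_cube.
  rewrite [X in (X * _)%E]IH exprSr EFinM; congr (_ * _)%E.
  apply: (etrans (lebesgue_measure_itv _)).
  rewrite /= lte_fin ifT; last by lra.
  by rewrite -EFinB mulr2n; congr EFin; ring.
apply/seteqP; split=> -[z t]/=.
  move=> H; split=> /=.
    move=> i; have := H (lift ord0 i).
    by rewrite !(tnth_nth 0)/= /bump leq0n add1n nth_behead.
  rewrite in_itv /= -ler_distlC distrC; have := H ord0.
  by rewrite !(tnth_nth 0).
move=> -[/= zc tc] i; case: (unliftP ord0 i) => [j|] ->.
  by have := zc j; rewrite !(tnth_nth 0)/= /bump leq0n add1n nth_behead.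
by move: tc; rewrite in_itv /= -ler_distlC distrC !(tnth_nth 0).
Qed.


Lemma measurable_eball n (c : Rn R n) r : measurable (eball c r).
Proof.
apply: measurable_Rn_borel.
rewrite (_ : eball c r = setT `&`
    (fun y : n.-tuple R => enorm_diff y c) @^-1` `]-oo, r[); last first.
  by rewrite setTI; apply/seteqP; split=> y /=; rewrite in_itv.
suff mc : measurable_fun setT (fun y : n.-tuple R => enorm_diff y c).
  by apply: mc => //; exact: measurable_itv.
have h : measurable_fun setT
    (fun y : n.-tuple R => \sum_(i < n) (tnth y i - tnth c i) ^+ 2).
  apply: measurable_sum => i; apply: measurable_funX.
  by apply: measurable_funB => //; exact: measurable_tnth.
exact: (measurableT_comp (continuous_measurable_fun (@sqrt_continuous R)) h).
Qed.

Lemma leb_cube n (c : Rn R n) rho : 0 < rho ->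
  @leb R n (cube c rho) = ((rho *+ 2) ^+ n)%:E.
Proof.
by move=> ?; rewrite leb_borel ?borel_measure_cube//; exact: measurable_cube.
Qed.

Lemma norm_tnthB_le_enorm_diff n (x y : Rn R n) i :
  `|tnth x i - tnth y i| <= enorm_diff x y.
Proof.
rewrite -sqrtr_sqr ler_wsqrtr// (bigD1 i)//= lerDl.
by rewrite sumr_ge0// => j _; exact: sqr_ge0.
Qed.

Lemma norm_tnth_le_enorm n (x : Rn R n) i : `|tnth x i| <= enorm x.
Proof.
rewrite -sqrtr_sqr ler_wsqrtr// (bigD1 i)//= lerDl.
by rewrite sumr_ge0// => j _; exact: sqr_ge0.
Qed.

Lemma eball_sub_cube n (c : Rn R n) r : eball c r `<=` cube c r.
Proof.
move=> y /= yc i; apply/ltW.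
exact: le_lt_trans (norm_tnthB_le_enorm_diff _ _ _) _.
Qed.

(** With t = r/(2n), a point of the cube has squared distance at most n t^2 < (2 n t)^2 = r^2 from
    [c]. *)
Lemma cube_sub_eball n (c : Rn R n) r : 0 < r -> (0 < n)%N ->
  cube c (r / (n%:R *+ 2)) `<=` eball c r.
Proof.
move=> r0 n0 y yc; have n1 : 1 <= n%:R :> R by rewrite ler1n.
rewrite /eball/= -(gtr0_norm r0) -sqrtr_sqr ltr_sqrt ?exprn_gt0//.
apply: (@le_lt_trans _ _ (\sum_(i < n) (r / (n%:R *+ 2)) ^+ 2)).
  apply: ler_sum => i _; rewrite -real_normK ?num_real// lerXn2r ?nnegrE//.
  by rewrite divr_ge0 ?ltW// pmulrn_lgt0// ltr0n.
have nr0 : 0 < n%:R *+ 2 :> R by rewrite pmulrn_lgt0// ltr0n.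
have t0 : 0 < r / (n%:R *+ 2) by rewrite divr_gt0.
rewrite -[X in _ < X ^+ 2](divfK (lt0r_neq0 nr0)).
move: (r / _) t0 => t t0; rewrite sumr_const card_ord -[ltLHS]mulr_natr.
by rewrite exprMn ltr_pM2l ?exprn_gt0// mulr2n; nra.
Qed.

Lemma leb_eball_fin n (c : Rn R n) r : 0 < r ->
  (@leb R n (eball c r) < +oo)%E.
Proof.
move=> r0; apply: (@le_lt_trans _ _ (@leb R n (cube c r))); last first.
  by rewrite leb_cube// ltry.
apply: le_measure; rewrite ?inE; [exact: measurable_eball| |exact: eball_sub_cube].
by apply: measurable_Rn_borel; exact: measurable_cube.
Qed.

Lemma leb_eball_ge n (c : Rn R n) r : 0 < r -> (0 < n)%N ->
  (((r / n%:R) ^+ n)%:E <= @leb R n (eball c r))%E.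
Proof.
move=> r0 n0; have n0' : 0 < n%:R :> R by rewrite ltr0n.
rewrite (_ : r / _ = (r / (n%:R *+ 2)) *+ 2); last by rewrite mulr2n; field; lra.
rewrite -(leb_cube c); last by rewrite divr_gt0// pmulrn_lgt0.
apply: le_measure; rewrite ?inE; [|exact: measurable_eball|exact: cube_sub_eball].
by apply: measurable_Rn_borel; exact: measurable_cube.
Qed.

End lebesgue_measure_of_cubes.

(** * Monotonicity of the integral and integrals of step functions *)

Section integral_complements.
Local Open Scope ereal_scope.
Local Open Scope classical_set_scope.
Context d (T : measurableType d) (R : realType).
Variable mu : {measure set T -> \bar R}.

(* No measurability is needed: the integral of a nonnegative function is the
   supremum of the integrals of the simple functions below it. *)
Lemma le_integralT (f g : T -> \bar R) :
  (forall x, 0 <= f x) -> (forall x, f x <= g x) ->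
  \int[mu]_x f x <= \int[mu]_x g x.
Proof.
move=> f0 fg; rewrite !ge0_integralTE//; last first.
  by move=> x; exact: le_trans (fg x).
apply: le_ereal_sup => _ [h /= hf <-]; exists h => //= x.
exact: le_trans (fg x).
Qed.

Lemma integral_scale_indic (A : set T) (k : R) : measurable A -> (0 <= k)%R ->
  \int[mu]_x (k * \1_A x)%:E = k%:E * mu A.
Proof.
move=> mA k0; under eq_integral do rewrite EFinM.
rewrite ge0_integralZl_EFin//; last by apply/measurable_EFinP.
by rewrite integral_indic// setIT.
Qed.

Lemma integral_scale_indicD (A1 A2 : set T) (k1 k2 : R) :
  measurable A1 -> measurable A2 -> (0 <= k1)%R -> (0 <= k2)%R ->
  \int[mu]_x ((k1 * \1_A1 x)%:E + (k2 * \1_A2 x)%:E) =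
  k1%:E * mu A1 + k2%:E * mu A2.
Proof.
move=> mA1 mA2 k10 k20; rewrite -!integral_scale_indic// ge0_integralD//.
- by move=> x _; rewrite lee_fin mulr_ge0.
- by apply/measurable_EFinP; apply: measurable_funM.
- by move=> x _; rewrite lee_fin mulr_ge0.
- by apply/measurable_EFinP; apply: measurable_funM.
Qed.

End integral_complements.

(** * Two-sided bounds for the Luxemburg norm of an indicator *)

Section luxemburg_norm_of_indicators.
Local Open Scope classical_set_scope.
Variables (R : realType) (n : nat).
Local Notation Rn := (Rn R n).
Local Notation mu := (@leb R n).

(** V^(-A/a) = V^((a - A)/a) / V, and the logarithm of V^((a - A)/a) is at most L/al in absolute
    value. In this way a variable exponent is traded for the constant [A]. *)
Lemma powR_log_Hoelder (V A a al L : R) : 0 < V -> 0 < al -> al <= a ->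
  `|a - A| * `|ln V| <= L ->
  expR (- (L / al)) / V <= V `^ (- (A / a)) <= expR (L / al) / V.
Proof.
move=> V0 al0 ala H; have a0 : 0 < a by lra.
rewrite /powR gt_eqF//.
rewrite (_ : - (A / a) * ln V = (a - A) * ln V / a - ln V); last first.
  by field; lra.
rewrite expRB lnK ?posrE//.
suff /andP[? ?] : - (L / al) <= (a - A) * ln V / a <= L / al.
  by rewrite !ler_pM2r ?invr_gt0// !ler_expR; apply/andP.
rewrite -ler_norml !normrM normfV (gtr0_norm a0) ler_pM//.
  by rewrite invr_ge0 ltW.
by rewrite lef_pV2 ?posrE.
Qed.

Lemma chi_powR (q : Rn -> R) (B : set Rn) l x : q x != 0 -> 0 < l ->
  ((`|chi B x| / l%:E) `^ q x)%E = ((l^-1 `^ q x) * \1_B x)%:E.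
Proof.
move=> qx l0; rewrite /chi indicE; case: (x \in B) => /=.
  by rewrite normr1 mul1e inver gt_eqF// mulr1 poweR_EFin.
by rewrite normr0 mul0e poweR_EFin powR0 ?mulr0.
Qed.

Section bounds.
Variables (a q : Rn -> R) (B E : set Rn) (V A al L m M K : R).

(** Here [a] is 1/q, [A] the constant replacing it, and [E] the part of [B] where only the crude
    bound [M] is known. At l = K V^A the integrand is at most K^-1 V^(-A/a), as q >= 1 and K >= 1,
    so the modular is at most K^-1 (exp(L/al) + M m) <= 1. *)
Lemma vnorm_chi_le :
  (forall x, q x = (a x)^-1) -> 0 < al -> (forall x, al <= a x <= 1) ->
  measurable B -> measurable E -> E `<=` B ->
  0 < V -> mu B = V%:E -> mu E = m%:E ->
  (forall x, B x -> ~ E x -> `|a x - A| * `|ln V| <= L) -> 0 <= L ->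
  K = 3 * expR (L / al) ->
  (forall x, E x -> V `^ (- (A / a x)) <= M) ->
  0 <= M -> M * m <= 1 -> (vnorm q (chi B) <= (K * V `^ A)%:E)%E.
Proof.
move=> qE al0 aB mB mE EB V0 muB muE good L0 KE EM M0 Mm.
have q1 x : 1 <= q x by have /andP[? ?] := aB x; rewrite qE invf_ge1//; lra.
have q0 x : q x != 0 by rewrite gt_eqF// (lt_le_trans _ (q1 x)).
have e1 : 1 <= expR (L / al) by rewrite -expR0 ler_expR divr_ge0// ltW.
have K3 : 3 <= K by rewrite KE ler_peMr.
have powRVA x : (V `^ A)^-1 `^ q x = V `^ (- (A / a x)).
  by rewrite -powRN -powRrM qE mulNr.
have VA0 : 0 < V `^ A by rewrite powR_gt0.
have KVA0 : 0 < K * V `^ A by rewrite mulr_gt0//; lra.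
apply: ereal_inf_lbound; exists (K * V `^ A) => //; split => //.
apply: (@le_trans _ _ (\int[mu]_x
    ((K^-1 * (expR (L / al) / V) * \1_B x)%:E + (K^-1 * M * \1_E x)%:E))%E).
  apply: le_integralT => x; first exact: poweR_ge0.
  rewrite chi_powR// !indicE -EFinD lee_fin.
  have [xB|xB] := boolP (x \in B); last first.
    rewrite !mulr0 add0r; apply: mulr_ge0 => //; apply: mulr_ge0 => //.
    by rewrite invr_ge0; lra.
  rewrite mulr1 invfM powRM ?invr_ge0//; [|lra|lra].
  rewrite powRVA; apply: (@le_trans _ _ (K^-1 * V `^ (- (A / a x)))).
    rewrite ler_wpM2r ?powR_ge0// ge1r_powR// invr_gt0 invf_le1; lra.
  rewrite -!mulrA -mulrDr ler_wpM2l ?invr_ge0//; first by lra.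
  have := xB; rewrite inE => Bx.
  have [xE|xE] := boolP (x \in E).
    rewrite !mulr1; apply: (le_trans (EM x _)); first by rewrite -inE.
    by rewrite lerDr divr_ge0//; lra.
  rewrite mulr1 mulr0 addr0; have /andP[ala _] := aB x.
  have nE : ~ E x by move=> /mem_set Ex; move: xE; rewrite Ex.
  by have /andP[] := powR_log_Hoelder V0 al0 ala (good x Bx nE).
rewrite integral_scale_indicD//; last 2 first.
- by rewrite mulr_ge0 ?invr_ge0 ?divr_ge0//; lra.
- by rewrite mulr_ge0// invr_ge0; lra.
rewrite [X in (X + _)%E](_ : _ = (K^-1 * expR (L / al))%:E); last first.
  by rewrite -[LHS]/(_ * mu B)%E muB -EFinM; congr EFin; field; lra.
rewrite -[X in (_ + _ * X)%E]/(mu E) muE -EFinM -EFinD lee_fin.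
by rewrite -mulrA -mulrDr ler_pdivrMl ?mulr1 KE; lra.
Qed.

(** For l < K^-1 V^A the integrand on B \ E is at least K V^(-A/a) >= K exp(-L/al) / V = 3/V. Since
    B \ E has measure at least V/2, the modular is at least 3/2 and l is not admissible. *)
Lemma vnorm_chi_ge :
  (forall x, q x = (a x)^-1) -> 0 < al -> (forall x, al <= a x <= 1) ->
  measurable B -> measurable E -> E `<=` B ->
  0 < V -> mu B = V%:E -> mu E = m%:E ->
  (forall x, B x -> ~ E x -> `|a x - A| * `|ln V| <= L) -> 0 <= L ->
  K = 3 * expR (L / al) ->
  m <= V / 2 -> ((K^-1 * V `^ A)%:E <= vnorm q (chi B))%E.
Proof.
move=> qE al0 aB mB mE EB V0 muB muE good L0 KE mV.
have q1 x : 1 <= q x by have /andP[? ?] := aB x; rewrite qE invf_ge1//; lra.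
have q0 x : q x != 0 by rewrite gt_eqF// (lt_le_trans _ (q1 x)).
have e1 : 1 <= expR (L / al) by rewrite -expR0 ler_expR divr_ge0// ltW.
have K3 : 3 <= K by rewrite KE ler_peMr.
have powRVA x : (V `^ A)^-1 `^ q x = V `^ (- (A / a x)).
  by rewrite -powRN -powRrM qE mulNr.
have VA0 : 0 < V `^ A by rewrite powR_gt0.
apply: le_ereal_inf_tmp => _ [l [l0 +] <-]; rewrite lee_fin.
apply: contraPT; rewrite -ltNge => lK; apply/negP; rewrite -ltNge.
have muBE : mu (B `\` E) = (V - m)%:E.
  have Boo : (mu B < +oo)%E by rewrite muB ltry.
  apply: etrans (measureD mB mE Boo) _.
  by rewrite setIidr// -[LHS]/(mu B - mu E)%E muB muE.
apply: (@lt_le_trans _ _ (\int[mu]_x (3 / V * \1_(B `\` E) x)%:E)%E).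
  rewrite integral_scale_indic//; [|exact: measurableD|by rewrite divr_ge0// ltW].
  rewrite -[X in (_ * X)%E]/(mu (B `\` E)) muBE.
  rewrite -EFinM lte_fin mulrAC ltr_pdivlMr//; lra.
apply: le_integralT => x; first by rewrite lee_fin mulr_ge0// divr_ge0// ltW.
rewrite chi_powR// lee_fin !indicE.
have [/set_mem[Bx Ex]|xBE] := boolP (x \in B `\` E); last first.
  by rewrite mulr0 mulr_ge0// powR_ge0.
rewrite (mem_set Bx) !mulr1; have /andP[ala a1] := aB x.
have /andP[+ _] := powR_log_Hoelder V0 al0 ala (good x Bx Ex).
rewrite -powRVA => H.
apply: (@le_trans _ _ ((K * (V `^ A)^-1) `^ q x)); last first.
  rewrite ge0_ler_powR ?nnegrE ?mulr_ge0 ?invr_ge0//; try lra.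
  - by have := q1 x; lra.
  - by rewrite -[K]invrK -invfM lef_pV2 ?posrE// ?ltW// mulr_gt0// invr_gt0; lra.
rewrite powRM ?invr_ge0//; try lra.
apply: (@le_trans _ _ (K * ((V `^ A)^-1 `^ q x))); last first.
  by rewrite ler_wpM2r ?powR_ge0// le1r_powR//; lra.
apply: le_trans (ler_wpM2l _ H); last by lra.
rewrite KE expRN [leRHS](_ : _ = 3 / V)//; field.
by apply/andP; split; lra.
Qed.

End bounds.

End luxemburg_norm_of_indicators.

(** * Norms of indicators of balls for log-Hoelder exponents *)

Section luxemburg_norm_of_balls.
Local Open Scope classical_set_scope.
Variables (R : realType) (n : nat).
Hypothesis n_gt0 : (0 < n)%N.
Local Notation Rn := (Rn R n).
Local Notation mu := (@leb R n).

(** The constant is made explicit so that one bound can serve several exponents. *)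
Definition log_Hoelder_cst (C : R) (a : Rn -> R) :=
  (forall x y, `|a x - a y| <= C / ln (expR 1 + (enorm_diff x y)^-1)) /\
  (forall x y, enorm x <= enorm y ->
     `|a x - a y| <= C / ln (expR 1 + enorm x)).

Lemma enorm_diff_eq0 (x y : Rn) : enorm_diff x y = 0 -> x = y.
Proof.
move=> xy0; apply: eq_from_tnth => i; apply/eqP; rewrite -subr_eq0 -normr_le0.
by rewrite -xy0; exact: norm_tnthB_le_enorm_diff.
Qed.

Lemma ln_expR1D_ge1 (t : R) : 0 <= t -> 1 <= ln (expR 1 + t).
Proof.
move=> t0; rewrite -[leLHS]expRK ler_ln ?posrE ?expR_gt0 ?lerDl//.
by rewrite ltr_wpDr// expR_gt0.
Qed.

Lemma ln_expR1D_ge (t : R) : 0 < t -> ln t <= ln (expR 1 + t).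
Proof.
move=> t0; rewrite ler_ln ?posrE// ?lerDr ?expR_ge0//.
by rewrite ltr_wpDr ?expR_gt0// ltW.
Qed.

(** Put l = ln(e + 1/|x - c|). Then l >= 1 and l >= -ln r, so (r/n)^n <= V gives -ln V <= n (1 + ln
    n) l, and l cancels against the bound C/l. *)
Lemma log_Hoelder_near (C : R) (a : Rn -> R) (c x : Rn) (r V : R) :
  0 <= C -> log_Hoelder_cst C a -> 0 < r -> 0 < V < 1 ->
  (r / n%:R) ^+ n <= V -> enorm_diff x c < r ->
  `|a x - a c| * `|ln V| <= C * (n%:R * (1 + ln n%:R)).
Proof.
move=> C0 [aC _] r0 /andP[V0 V1] rV xc.
have n1 : 1 <= n%:R :> R by rewrite ler1n.
have n0 : 0 < n%:R :> R by rewrite ltr0n.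
have lnn : 0 <= ln n%:R :> R by exact: ln_ge0.
(* The case x = c is separate because 0^-1 = 0, so that l need not dominate -ln r. *)
have [xc0|xc0] := eqVneq (enorm_diff x c) 0.
  by rewrite (enorm_diff_eq0 xc0) subrr normr0 mul0r !mulr_ge0// addr_ge0.
have d0 : 0 < enorm_diff x c by rewrite lt0r xc0 sqrtr_ge0.
have := aC x c; set l := ln _ => axc.
have l1 : 1 <= l by rewrite ln_expR1D_ge1// invr_ge0 ltW.
have lr : - ln r <= l.
  rewrite -lnV ?posrE// (@le_trans _ _ (ln (enorm_diff x c)^-1))//.
    by rewrite ler_ln ?posrE ?invr_gt0// lef_pV2 ?posrE// ltW.
  by apply: ln_expR1D_ge; rewrite invr_gt0.
clearbody l; have lnV : - ln V <= n%:R * (1 + ln n%:R) * l.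
  have : ln ((r / n%:R) ^+ n) <= ln V.
    by rewrite ler_ln ?posrE// exprn_gt0// divr_gt0.
  rewrite lnXn ?divr_gt0// ln_div ?posrE//.
  rewrite -[X in X <= ln V]mulr_natl => H.
  apply: (@le_trans _ _ (n%:R * (l + ln n%:R * l))).
    apply: (@le_trans _ _ (n%:R * (- ln r + ln n%:R))); first by lra.
    by rewrite ler_pM2l//; nra.
  by lra.
rewrite (ler0_norm (ln_le0 (ltW V1))).
apply: (@le_trans _ _ (C / l * (n%:R * (1 + ln n%:R) * l))).
  by rewrite ler_pM// oppr_ge0; apply: ln_le0; exact: ltW.
by rewrite le_eqVlt; apply/orP; left; apply/eqP; field; lra.
Qed.

(** Put l = ln(e + |x|). The lower bound on |x| gives l >= (al/n) ln V - ln 4, hence ln V <= (n/al)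
    (1 + ln 4) l, and l cancels against the decay bound C/l. *)
Lemma log_Hoelder_far (C al : R) (a : Rn -> R) (x z : Rn) (V : R) :
  0 <= C -> 0 < al -> log_Hoelder_cst C a -> 1 <= V ->
  V `^ (al / n%:R) / 4 < enorm x -> enorm x <= enorm z ->
  `|a x - a z| * `|ln V| <= C * (n%:R / al * (1 + ln 4)).
Proof.
move=> C0 al0 [_ aC] V1 xV xz.
have n0 : 0 < n%:R :> R by rewrite ltr0n.
have ln4 : 0 <= ln 4 :> R by rewrite ln_ge0//; lra.
have := aC x z xz; set l := ln _ => axz.
have l1 : 1 <= l by rewrite ln_expR1D_ge1// sqrtr_ge0.
have V4 : 0 < V `^ (al / n%:R) / 4 by rewrite divr_gt0// powR_gt0; lra.
have x0 := lt_trans V4 xV.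
have lV : al / n%:R * ln V - ln 4 <= l.
  rewrite -ln_powR -ln_div ?posrE ?powR_gt0//; last by lra.
  apply: (@le_trans _ _ (ln (enorm x))).
    by rewrite ler_ln ?posrE//; exact: ltW.
  exact: ln_expR1D_ge.
clearbody l; have lnV : ln V <= n%:R / al * (1 + ln 4) * l.
  rewrite [leLHS](_ : _ = n%:R / al * (al / n%:R * ln V)); last first.
    by field; apply/andP; split; lra.
  by rewrite -[leRHS]mulrA ler_pM2l ?divr_gt0//; nra.
rewrite (ger0_norm (ln_ge0 V1)).
apply: (@le_trans _ _ (C / l * (n%:R / al * (1 + ln 4) * l))).
  by rewrite ler_pM// ln_ge0.
by rewrite le_eqVlt; apply/orP; left; apply/eqP; field; apply/andP; split; lra.
Qed.

(** The point on the right depends on the ball only; its coordinates dominate every |y_i| because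
    |y_i| <= |c_i| + r. *)
Lemma eball_enorm_le (c y : Rn) (r : R) : eball c r y ->
  enorm y <= enorm ([tuple of nseq n (\sum_i `|tnth c i| + r)] : Rn).
Proof.
move=> yc; apply: ler_wsqrtr; apply: ler_sum => i _.
rewrite {2}/tnth nth_nseq ltn_ord -real_normK ?num_real//.
have yi : `|tnth y i| <= \sum_i `|tnth c i| + r.
  rewrite -[tnth y i](subrK (tnth c i)) addrC (le_trans (ler_normD _ _))//.
  rewrite lerD//; last exact: (le_trans (norm_tnthB_le_enorm_diff _ _ _)) (ltW yc).
  by rewrite (bigD1 i)//= lerDl sumr_ge0.
by rewrite lerXn2r ?nnegrE// (le_trans _ yi).
Qed.

(** The order of quantifiers matters: [K] precedes the ball, and [z] precedes the exponent, so that
    relations between several exponents can be used at a common point. *)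
Lemma vnorm_chi_eball (C al : R) : 0 <= C -> 0 < al -> exists2 K : R, 0 < K &
  forall (c : Rn) (r V : R), 0 < r -> mu (eball c r) = V%:E -> 0 < V ->
  exists z : Rn, forall a q : Rn -> R,
    (forall x, q x = (a x)^-1) -> (forall x, al <= a x <= 1) ->
    log_Hoelder_cst C a ->
    ((K^-1 * V `^ a z)%:E <= vnorm q (chi (eball c r)) <= (K * V `^ a z)%:E)%E.
Proof.
move=> C0 al0; have n0 : 0 < n%:R :> R by rewrite ltr0n.
pose L := C * (n%:R * (1 + ln n%:R)) + C * (n%:R / al * (1 + ln 4)).
have L1 : 0 <= C * (n%:R * (1 + ln n%:R)).
  by rewrite mulr_ge0 ?mulr_ge0 ?addr_ge0 ?ln_ge0// ?ler1n// ltW.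
have L2 : 0 <= C * (n%:R / al * (1 + ln 4)).
  rewrite mulr_ge0 ?mulr_ge0 ?invr_ge0 ?addr_ge0 ?ln_ge0// ?(ltW al0)//; lra.
have L0 : 0 <= L by exact: addr_ge0.
exists (3 * expR (L / al)); first by rewrite mulr_gt0 ?expR_gt0.
move=> c r V r0 muB V0; have mB := measurable_eball c r.
have [V1|V1] := ltP V 1.
  (* In a small ball the center can be compared with every point, so the exceptional set is
     empty. *)
  exists c => a q qE aal aC.
  have good x : eball c r x -> ~ set0 x -> `|a x - a c| * `|ln V| <= L.
    move=> xc _; rewrite (@le_trans _ _ (C * (n%:R * (1 + ln n%:R))))//.
      apply: log_Hoelder_near xc => //; first by rewrite V0.
      by rewrite -lee_fin -muB; exact: leb_eball_ge.
    by rewrite lerDl.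
  apply/andP; split.
    apply: (vnorm_chi_ge qE al0 aal mB (E := set0) (m := 0) (L := L)) => //.
      by rewrite measure0.
    by rewrite divr_ge0// ltW.
  apply: (vnorm_chi_le qE al0 aal mB (E := set0) (m := 0) (M := 0) (L := L)) => //.
    by rewrite measure0.
exists [tuple of nseq n (\sum_i `|tnth c i| + r)] => a q qE aal aC.
set z := [tuple of _].
(* Outside [Q] the norm exceeds [rho], as the decay estimate requires, while |Q| = V^al / 2^n <=
   V^al / 2. *)
pose rho := V `^ (al / n%:R) / 4.
have rho0 : 0 < rho by rewrite divr_gt0// powR_gt0.
pose Q : set Rn := cube [tuple of nseq n 0] rho.
have mQ : measurable Q by apply: measurable_Rn_borel; exact: measurable_cube.
pose E := eball c r `&` Q.
have mE : measurable E by exact: measurableI.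
have muQ : mu Q = ((rho *+ 2) ^+ n)%:E by exact: leb_cube.
have al1 : al <= 1 by have /andP[] := aal z; exact: le_trans.
have rhoV : (rho *+ 2) ^+ n <= V `^ al / 2.
  rewrite (_ : rho *+ 2 = V `^ (al / n%:R) / 2); last by rewrite mulr2n /rho; lra.
  rewrite expr_div_n -powR_mulrn ?powR_ge0// -powRrM divfK ?gt_eqF//.
  rewrite ler_pM2l ?powR_gt0// lef_pV2 ?posrE ?exprn_gt0//.
  by rewrite -[leLHS]expr1 ler_eXn2l// ltr1n.
have EQ : (mu E <= ((rho *+ 2) ^+ n)%:E)%E.
  by rewrite -muQ; apply: le_measure; rewrite ?inE//; exact: subIsetr.
have Efin : mu E \is a fin_num.
  by rewrite ge0_fin_numE ?measure_ge0// (le_lt_trans EQ)// ltry.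
have muE : mu E = (fine (mu E))%:E by rewrite fineK.
have mEV : fine (mu E) <= V `^ al / 2.
  by rewrite -lee_fin -muE (le_trans EQ)// lee_fin.
have EB : E `<=` eball c r by exact: subIsetl.
have good x : eball c r x -> ~ E x -> `|a x - a z| * `|ln V| <= L.
  move=> xB xE; rewrite (@le_trans _ _ (C * (n%:R / al * (1 + ln 4))))//; last first.
    by rewrite lerDr.
  apply: log_Hoelder_far => //; last exact: eball_enorm_le.
  rewrite ltNge; apply/negP => xrho; apply: xE; split => // i.
  rewrite {2}/tnth nth_nseq ltn_ord subr0.
  exact: (le_trans (norm_tnth_le_enorm _ _)).
apply/andP; split.
  apply: (vnorm_chi_ge qE al0 aal mB mE EB V0 muB muE good L0) => //.
  apply: (le_trans mEV); rewrite ler_pM2r ?invr_gt0//.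
  exact: ler1_powR.
(* On [E] only al <= a z and a x <= 1 are used: they give a z / a x >= al. Then M m <= V^(-al) V^al
   / 2 <= 1. *)
apply: (vnorm_chi_le qE al0 aal mB mE EB V0 muB muE good L0 _ (M := V `^ (- al))) => //.
- move=> x _; apply: ler_powR => //; rewrite lerN2.
  have /andP[alx x1] := aal x; have /andP[alz _] := aal z.
  by rewrite ler_pdivlMr; [nra|lra].
- by rewrite powR_ge0.
- rewrite (@le_trans _ _ (V `^ (- al) * (V `^ al / 2)))//.
    by rewrite ler_wpM2l// powR_ge0.
  by rewrite powRN mulrA mulVf ?gt_eqF ?powR_gt0//; lra.
Qed.

End luxemburg_norm_of_balls.

(** * Hoelder's inequality in terms of modulars *)

Section luxemburg_hoelder.
Local Open Scope classical_set_scope.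
Local Open Scope ereal_scope.
Context d (T : measurableType d) (R : realType).
Variable mu : {measure set T -> \bar R}.

(** With a nonzero exponent the power vanishes where the base does, and elsewhere it is an
    exponential. *)
Lemma measurable_fun_powR2 (g q : T -> R) : (forall x, q x != 0%R) ->
  measurable_fun [set: T] g -> measurable_fun [set: T] q ->
  measurable_fun [set: T] (fun x => g x `^ q x)%R.
Proof.
move=> q0 mg mq; have -> : (fun x => g x `^ q x)%R =
    (fun x => if g x == 0 then 0 else expR (q x * ln (g x)))%R.
  by apply/funext => x; rewrite /powR (negbTE (q0 x)).
apply: measurable_fun_ifT => //; first exact: measurable_fun_eqr.
apply: measurableT_comp => //; apply: measurable_funM => //.
by apply: (measurableT_comp (@measurable_ln R)).
Qed.

(** Young's inequality gives t <= g h <= g^q / q + h^q' / q' <= g^q + h^q' almost everywhere on [B];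
    integrating, each modular contributes at most 1. *)
Lemma luxemburg_hoelder (g h q q' : T -> R) (B : set T) (t : R) :
  measurable B -> measurable_fun [set: T] g -> measurable_fun [set: T] h ->
  measurable_fun [set: T] q -> measurable_fun [set: T] q' ->
  (forall x, 1 < q x)%R -> (forall x, (q x)^-1 + (q' x)^-1 = 1)%R ->
  (0 <= t)%R ->
  {ae mu, forall x, B x -> [/\ 0 <= g x, 0 <= h x & t <= g x * h x]%R} ->
  \int[mu]_x ((g x * \1_B x) `^ q x)%:E <= 1 ->
  \int[mu]_x ((h x * \1_B x) `^ q' x)%:E <= 1 ->
  t%:E * mu B <= 2%:E.
Proof.
move=> mB mg mh mq mq' q1 qq' t0 gh Ig Ih.
have q0 x : (0 < q x)%R by apply: lt_trans (q1 x).
have q'E x : ((q' x)^-1 = 1 - (q x)^-1)%R by rewrite -(qq' x); lra.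
have qi x : (0 < (q x)^-1 < 1)%R by rewrite invr_gt0 q0 invf_lt1 ?q1.
have q'0 x : (0 < q' x)%R by rewrite -invr_gt0 q'E; have := qi x; lra.
have mgq : measurable_fun [set: T] (fun x => ((g x * \1_B x) `^ q x)%:E).
  apply/measurable_EFinP; apply: measurable_fun_powR2 => //.
    by move=> x; rewrite gt_eqF.
  by apply: measurable_funM.
have mhq : measurable_fun [set: T] (fun x => ((h x * \1_B x) `^ q' x)%:E).
  apply/measurable_EFinP; apply: measurable_fun_powR2 => //.
    by move=> x; rewrite gt_eqF.
  by apply: measurable_funM.
apply: (@le_trans _ _ (\int[mu]_x (((g x * \1_B x) `^ q x)%:E +
    ((h x * \1_B x) `^ q' x)%:E))); last first.
  rewrite ge0_integralD//; try by move=> x _; rewrite lee_fin powR_ge0.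
  by rewrite (_ : 2%:E = 1 + 1)//; exact: leeD.
rewrite -integral_scale_indic//.
apply: ae_ge0_le_integral => //.
- by move=> x _; rewrite lee_fin mulr_ge0.
- by apply/measurable_EFinP; apply: measurable_funM.
- by move=> x _; rewrite lee_fin addr_ge0// powR_ge0.
- exact: emeasurable_funD.
apply: filterS gh => x gh _; rewrite -EFinD lee_fin indicE.
have [/set_mem Bx|_] := boolP (x \in B); last by rewrite mulr0 addr_ge0// powR_ge0.
have [gx hx tx] := gh Bx; rewrite !mulr1; apply: (le_trans tx).
apply: (le_trans (conjugate_powR gx hx (q0 x) (q'0 x) (qq' x))).
have /andP[? ?] := qi x.
by apply: lerD; rewrite ler_piMr ?powR_ge0// ?q'E; lra.
Qed.

End luxemburg_hoelder.

(** * Rational cubes in balls and essential suprema *)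

Section cubes_in_balls.
Local Open Scope classical_set_scope.
Variables (R : realType) (n : nat).
Local Notation Rn := (Rn R n).
Local Notation mu := (@leb R n).

Lemma cube_sub_eball_center (c x : Rn) (r : R) : eball c r x ->
  exists2 e : R, 0 < e & cube x e `<=` eball c r.
Proof.
move=> xc; have r0 : 0 < r by exact: le_lt_trans (sqrtr_ge0 _) xc.
have d0 : 0 <= enorm_diff x c by exact: sqrtr_ge0.
pose s := r ^+ 2 - enorm_diff x c ^+ 2.
have s0 : 0 < s by rewrite subr_gt0 ltrXn2r.
have n0 : 0 <= n%:R :> R by [].
have D0 : 0 < n%:R * (2 * r + 1) + s by rewrite ltr_wpDl// mulr_ge0//; lra.
(* As e <= 1, each squared coordinate grows by at most e (2 r + 1), in total by n e (2 r + 1) = s -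
   e s < s. *)
pose e := s / (n%:R * (2 * r + 1) + s).
have eD : e * (n%:R * (2 * r + 1) + s) = s by rewrite divfK// gt_eqF.
have e0 : 0 < e by rewrite divr_gt0.
have e1 : e <= 1.
  by rewrite ler_pdivrMr// mul1r lerDr mulr_ge0//; lra.
exists e => // y ye.
rewrite /eball/= -(gtr0_norm r0) -sqrtr_sqr ltr_sqrt ?exprn_gt0//.
apply: (@le_lt_trans _ _ (\sum_(i < n)
    ((tnth x i - tnth c i) ^+ 2 + e * (2 * r + 1)))).
  apply: ler_sum => i _; have yx := ye i.
  have := le_lt_trans (norm_tnthB_le_enorm_diff x c i) xc.
  rewrite (_ : tnth y i - tnth c i =
    (tnth x i - tnth c i) + (tnth y i - tnth x i)); last by ring.
  move: yx; move: (tnth y i - tnth x i) (tnth x i - tnth c i) => u v.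
  by rewrite ler_norml ltr_norml => /andP[? ?] /andP[? ?]; nra.
rewrite big_split/= sumr_const card_ord -[X in _ + X]mulr_natl.
have -> : \sum_(i < n) (tnth x i - tnth c i) ^+ 2 = enorm_diff x c ^+ 2.
  by rewrite sqr_sqrtr// sumr_ge0// => i _; exact: sqr_ge0.
have es : 0 < e * s by rewrite mulr_gt0.
rewrite -ltrBrDl -/s; nra.
Qed.

(** The rational center is within 1/(m+1) < e/2 of [x] in each coordinate, so the rational cube
    stays inside the cube of half-side e about [x]. *)
Lemma rational_cube_sub_eball (c x : Rn) (r : R) : eball c r x ->
  exists (a : n.-tuple rat) (m : nat),
    let Q : set Rn := cube [tuple of map ratr a] m.+1%:R^-1 in
    Q x /\ Q `<=` eball c r.
Proof.
move=> /cube_sub_eball_center[e e0 xe].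
have [m me] : exists m, m.+1%:R^-1 < e / 2 :> R.
  have [m mP] := ltr_add_invr (divr_gt0 e0 (ltr0Sn _ 1)).
  by exists m; rewrite add0r in mP.
have m0 : 0 < m.+1%:R^-1 :> R by rewrite invr_gt0.
have ex i : exists b : rat, `|tnth x i - ratr b| <= m.+1%:R^-1.
  move: (_^-1) m0 => rho rho0.
  have [|b] := @rat_in_itvoo R (tnth x i - rho) (tnth x i + rho); first by lra.
  by rewrite in_itv/= => ?; exists b; rewrite distrC ler_distl; lra.
have [b bP] := choice ex.
exists [tuple b i | i < n], m => /=.
have tb i : tnth [tuple of map ratr [tuple b i | i < n]] i = ratr (b i) :> R.
  by rewrite tnth_map tnth_mktuple.
split=> [i|y yQ]; first by rewrite tb.
apply: xe => i; have := yQ i; have := bP i; rewrite tb => xb yb.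
rewrite (_ : _ - _ = (tnth y i - ratr (b i)) - (tnth x i - ratr (b i))); last by ring.
apply: (le_trans (ler_normB _ _)); apply: (le_trans (lerD yb xb)).
by move: (_^-1) me => rho ?; lra.
Qed.

(** The norm of exponent +oo is defined as the essential supremum only when the whole space has
    positive measure. *)
Lemma leb_setT_gt0 : (0 < n)%N -> (0 < mu [set: Rn])%E.
Proof.
move=> n0; apply: (@lt_le_trans _ _ (mu (eball ([tuple of nseq n 0] : Rn) 1))).
  apply: lt_le_trans (leb_eball_ge _ ltr01 n0).
  by rewrite lte_fin exprn_gt0// divr_gt0// ltr0n.
by apply: le_measure; rewrite ?inE//; exact: measurable_eball.
Qed.

Lemma LnormyE (F : Rn -> \bar R) : (0 < n)%N ->
  Lnorm mu +oo F = ess_sup mu (fun x => `|F x|%E).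
Proof. by move=> /leb_setT_gt0 h; rewrite unlock h. Qed.

(* The exceptional null set must not depend on the ball, hence the detour
   through the countably many rational cubes. *)
Lemma ae_le_Lnormy_eball (g : Rn -> R) : (0 < n)%N ->
  {ae mu, forall x, forall c r, eball c r x ->
    (`|g x|%:E <= Lnorm mu +oo (fun y => (g y)%:E * chi (eball c r) y))%E}.
Proof.
(* [Q] enumerates the rational cubes, with the empty set at numbers that code none. *)
move=> n0; pose Q k : set Rn :=
  if @unpickle (n.-tuple rat * nat)%type k is Some am
  then cube [tuple of map ratr am.1] am.2.+1%:R^-1 else set0.
pose F (A : set Rn) y := `|(g y)%:E * chi A y|%E.
have : {ae mu, forall x, forall k, (F (Q k) x <= ess_sup mu (F (Q k)))%E}.
  by apply/ae_foralln => k; exact: ess_sup_ge.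
apply: filterS => x FQ c r /rational_cube_sub_eball[a [m [Qx QB]]].
have := FQ (pickle (a, m)); rewrite /Q pickleK /=; set A := cube _ _ => FA.
have -> : (`|g x|%:E = F A x)%E by rewrite /F /chi indicE mem_set// mule1.
rewrite LnormyE//; apply: (le_trans FA); apply: le_ess_sup; apply: nearW => y.
rewrite /F !abseM lee_wpmul2l// /chi !indicE.
have [/set_mem Ay|_] := boolP (y \in A); last by rewrite abse0 abse_ge0.
by rewrite mem_set//; exact: QB.
Qed.

End cubes_in_balls.

(** * Conjugate exponents and the product estimate on balls *)

Section sharp_maximal_comparison.
Local Open Scope classical_set_scope.
Variables (R : realType) (n : nat).
Local Notation Rn := (Rn R n).
Local Notation mu := (@leb R n).

Lemma conj_expE (p : Rn -> R) x : 1 < p x ->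
  conj_exp p x = (1 - (p x)^-1)^-1.
Proof.
move=> p1; rewrite /conj_exp /hoelder_conjugate /= eqe gt_eqF; last by lra.
rewrite -EFinB inver subr_eq0 gt_eqF//=.
by field; apply/andP; split; lra.
Qed.

Lemma log_Hoelder_cst_le (C C' : R) (a : Rn -> R) :
  C <= C' -> log_Hoelder_cst C a -> log_Hoelder_cst C' a.
Proof.
move=> CC' [a1 a2]; split=> [x y|x y xy].
  apply: (le_trans (a1 x y)); rewrite ler_wpM2r// invr_ge0.
  by apply: le_trans (ln_expR1D_ge1 _); rewrite ?invr_ge0 ?sqrtr_ge0.
apply: (le_trans (a2 x y xy)); rewrite ler_wpM2r// invr_ge0.
by apply: le_trans (ln_expR1D_ge1 _); rewrite ?sqrtr_ge0.
Qed.

(** The reciprocals differ by (p x - p y) / (p x p y) up to sign, and p x p y >= 1, so the constant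
    is kept. *)
Lemma log_Hoelder_cst_conj (C : R) (p : Rn -> R) : (forall x, 1 <= p x) ->
  log_Hoelder_cst C p -> log_Hoelder_cst C (fun x => 1 - (p x)^-1).
Proof.
move=> p1 [a1 a2].
suff H x y : `|(1 - (p x)^-1) - (1 - (p y)^-1)| <= `|p x - p y|.
  by split=> [x y|x y xy]; apply: (le_trans (H x y)) => //; exact: a2.
have := p1 x; have := p1 y => py px.
rewrite (_ : _ - _ = (p x - p y) * (p x * p y)^-1); last by field; lra.
rewrite normrM ler_piMr// normfV invf_le1 ?normr_gt0 ?mulf_neq0//; try lra.
by rewrite ger0_norm; nra.
Qed.

(** With a = 1/p' and b = 1/s' the combination 1 + a - b is 1/q' for 1/q = 1/p - 1/s. *)
Lemma log_Hoelder_cstB (C C' : R) (a b : Rn -> R) :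
  log_Hoelder_cst C a -> log_Hoelder_cst C' b ->
  log_Hoelder_cst (C + C') (fun x => 1 + a x - b x).
Proof.
move=> [a1 a2] [b1 b2].
have H x y : `|(1 + a x - b x) - (1 + a y - b y)| <= `|a x - a y| + `|b x - b y|.
  rewrite (_ : _ - _ = (a x - a y) - (b x - b y)); last by ring.
  exact: ler_normB.
split=> [x y|x y xy]; apply: (le_trans (H x y)); rewrite mulrDl lerD//.
  exact: a2.
exact: b2.
Qed.

Lemma vnorm_chi_eball_mul (p s q : Rn -> R) (b : R) : (0 < n)%N ->
  1 < b -> (forall x, b <= p x) -> (forall x, b <= s x) ->
  (forall x, 1 < q x) -> (forall x, (q x)^-1 = (p x)^-1 - (s x)^-1) ->
  log_Hoelder p -> log_Hoelder s ->
  exists2 K : R, 0 < K & forall (c : Rn) (r : R), 0 < r ->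
    exists V xs xq xp : R, [/\ 0 < V, mu (eball c r) = V%:E &
    [/\ 0 < xs, 0 < xp, 0 < xq & xs * xq <= K * V * xp] /\
    [/\ vnorm (conj_exp s) (chi (eball c r)) = xs%:E,
        vnorm (conj_exp q) (chi (eball c r)) = xq%:E &
        vnorm (conj_exp p) (chi (eball c r)) = xp%:E]].
Proof.
move=> n0 b1 bp bs q1 qE [Cp hp] [Cs hs].
have p1 x : 1 < p x by apply: lt_le_trans (bp x).
have s1 x : 1 < s x by apply: lt_le_trans (bs x).
pose C := `|Cp| + `|Cs|.
have ip x : 0 < (p x)^-1 <= b^-1.
  by rewrite invr_gt0 lef_pV2 ?posrE ?bp ?andbT; have := bp x; lra.
have is' x : 0 < (s x)^-1 <= b^-1.
  by rewrite invr_gt0 lef_pV2 ?posrE ?bs ?andbT; have := bs x; lra.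
have iq x : 0 < (q x)^-1 by rewrite invr_gt0; exact: lt_trans (q1 x).
have b0 : 0 < b^-1 < 1 by rewrite invr_gt0 invf_lt1 ?b1 ?andbT; lra.
pose ap x := 1 - (p x)^-1; pose as' x := 1 - (s x)^-1.
pose aq x := 1 + ap x - as' x.
have hap : log_Hoelder_cst `|Cp| ap.
  apply: log_Hoelder_cst_conj => [x|]; first exact: ltW.
  exact: log_Hoelder_cst_le (ler_norm _) _.
have has : log_Hoelder_cst `|Cs| as'.
  apply: log_Hoelder_cst_conj => [x|]; first exact: ltW.
  exact: log_Hoelder_cst_le (ler_norm _) _.
have haq : log_Hoelder_cst C aq by exact: log_Hoelder_cstB.
have {}hap : log_Hoelder_cst C ap.
  by apply: log_Hoelder_cst_le hap; rewrite lerDl.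
have {}has : log_Hoelder_cst C as'.
  by apply: log_Hoelder_cst_le has; rewrite lerDr.
have C0 : 0 <= C by rewrite addr_ge0.
have al0 : 0 < 1 - b^-1 by have := b0; lra.
have [K K0 HK] := vnorm_chi_eball n0 C0 al0.
(* One factor [K] for each of the upper bounds of [xs] and [xq], and one for the lower bound of
   [xp]. *)
exists (K ^+ 3); first by rewrite exprn_gt0.
move=> c r r0.
have Boo := leb_eball_fin c r0.
have Bfin : mu (eball c r) \is a fin_num by rewrite ge0_fin_numE.
have muB : mu (eball c r) = (fine (mu (eball c r)))%:E by rewrite fineK.
have V0 : 0 < fine (mu (eball c r)).
  rewrite -lte_fin -muB; apply: lt_le_trans (leb_eball_ge _ r0 n0).
  by rewrite lte_fin exprn_gt0// divr_gt0// ltr0n.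
set V := fine _ in muB V0; clearbody V.
have [z Hz] := HK c r V r0 muB V0.
(* The two-sided bound also forces the norm to be a positive real. *)
have bnd (e a : Rn -> R) : (forall x, e x = (a x)^-1) ->
    (forall x, 1 - b^-1 <= a x <= 1) -> log_Hoelder_cst C a ->
    exists2 xe, vnorm e (chi (eball c r)) = xe%:E &
      0 < xe /\ K^-1 * V `^ a z <= xe <= K * V `^ a z.
  move=> ea aal aC; have := Hz a e ea aal aC.
  have : 0 < K^-1 * V `^ a z by rewrite mulr_gt0 ?invr_gt0 ?powR_gt0.
  case: (vnorm e _) => [y| |] lo /andP[].
  - by rewrite !lee_fin => ? ?; exists y => //; split; [lra|apply/andP].
  - by move=> _; rewrite leye_eq.
  - by rewrite leeNy_eq.
have [xs Es [xs0 /andP[ls us]]] : exists2 xe,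
    vnorm (conj_exp s) (chi (eball c r)) = xe%:E &
      0 < xe /\ K^-1 * V `^ as' z <= xe <= K * V `^ as' z.
  apply: bnd => // x; first by rewrite conj_expE.
  by have := is' x; rewrite /as'; lra.
have [xp Ep [xp0 /andP[lp up]]] : exists2 xe,
    vnorm (conj_exp p) (chi (eball c r)) = xe%:E &
      0 < xe /\ K^-1 * V `^ ap z <= xe <= K * V `^ ap z.
  apply: bnd => // x; first by rewrite conj_expE.
  by have := ip x; rewrite /ap; lra.
have [xq Eq [xq0 /andP[lq uq]]] : exists2 xe,
    vnorm (conj_exp q) (chi (eball c r)) = xe%:E &
      0 < xe /\ K^-1 * V `^ aq z <= xe <= K * V `^ aq z.
  apply: bnd => // x; first by rewrite conj_expE// qE /aq /ap /as'; congr _^-1; ring.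
  by have := is' x; have := ip x; have := iq x; rewrite qE /aq /ap /as'; lra.
exists V, xs, xq, xp; split => //; split; split => //.
apply: (@le_trans _ _ ((K * V `^ as' z) * (K * V `^ aq z))).
  by rewrite ler_pM// ltW.
have -> : (K * V `^ as' z) * (K * V `^ aq z) = K ^+ 3 * V * (K^-1 * V `^ ap z).
  rewrite /aq; move: (as' z) (ap z) => u v.
  have Vn0 : V != 0 by rewrite gt_eqF.
  rewrite powRB ?Vn0 ?implybT// powRD ?Vn0 ?implybT// powRr1 ?(ltW V0)//.
  by field; rewrite !gt_eqF ?powR_gt0.
by rewrite ler_wpM2l// mulr_ge0// ltW// exprn_gt0.
Qed.

End sharp_maximal_comparison.

(** * Weighted duality and finiteness of the oscillation *)

Section weighted_luxemburg_duality.
Local Open Scope classical_set_scope.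
Context d (T : measurableType d) (R : realType).
Variable mu : {measure set T -> \bar R}.

Lemma measurable_fun_inv_ge0 (g : T -> R) : (forall x, 0 <= g x) ->
  measurable_fun [set: T] g -> measurable_fun [set: T] (fun x => (g x)^-1).
Proof.
move=> g0 mg; have -> : (fun x => (g x)^-1) = (fun x => g x `^ (-1)).
  by apply/funext => x; rewrite powR_inv1.
exact: (measurableT_comp (measurable_powR (-1))).
Qed.

(** Hoelder's inequality is applied to g = k |1/w| / l, dominated on [B] by |G| / l, and h = |w| /
    v; their product is k/(l v) wherever w > 0. The double inverse of [w] is the form in which the
    class of 1/w provides it. *)
Lemma luxemburg_duality (q q' w : T -> R) (G : T -> \bar R) (B : set T)
    (V k l v : R) :
  measurable_fun [set: T] q -> (forall x, 1 < q x) ->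
  (forall x, q' x = (1 - (q x)^-1)^-1) ->
  measurable_fun [set: T] w -> measurable_fun [set: T] (fun x => (w x)^-1) ->
  {ae mu, forall x, 0 < w x} ->
  measurable B -> mu B = V%:E -> 0 <= k ->
  (forall y, B y -> ((k * `|(w y)^-1|)%:E <= `|G y|)%E) ->
  0 < l -> (\int[mu]_x (`|G x| / l%:E) `^ (q x) <= 1)%E ->
  0 < v ->
  (\int[mu]_x (`|((w x)^-1)^-1%:E * (\1_B x)%:E| / v%:E) `^ (q' x) <= 1)%E ->
  k * V <= 2 * l * v.
Proof.
move=> mq q1 qc mw mwV w0 mB muB k0 kG l0 Il v0 Iv.
have qi x : 0 < (q x)^-1 < 1.
  by rewrite invr_gt0 invf_lt1 ?q1 ?andbT//; have := q1 x; lra.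
have q0 x : 0 < q x by apply: lt_trans (q1 x).
have qc0 x : 0 < q' x.
  by rewrite qc invr_gt0; have := qi x; lra.
have mqc : measurable_fun [set: T] q'.
  rewrite (_ : q' = fun x => (1 - (q x)^-1)^-1); last exact/funext.
  apply: measurable_fun_inv_ge0.
    by move=> x; have := qi x; lra.
  apply: measurable_funB => //; apply: measurable_fun_inv_ge0 => // x.
  exact: ltW.
pose g x := k / l * `|(w x)^-1|.
pose h x := v^-1 * `|w x|.
have kl0 : 0 <= k / l by rewrite divr_ge0// ltW.
have mg : measurable_fun [set: T] g.
  by apply: measurable_funM => //; exact: measurableT_comp.
have mh : measurable_fun [set: T] h.
  by apply: measurable_funM => //; exact: measurableT_comp.
have gh : {ae mu, forall x, B x ->
    [/\ 0 <= g x, 0 <= h x & k / (l * v) <= g x * h x]}.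
  apply: filterS w0 => x wx _; split.
  - by rewrite mulr_ge0.
  - by rewrite mulr_ge0// invr_ge0 ltW.
  - rewrite /g /h normfV [leRHS](_ : _ = k / (l * v))//.
    by field; rewrite normr_eq0 !gt_eqF.
have : ((k / (l * v))%:E * mu B <= 2%:E)%E.
  apply: (luxemburg_hoelder mB mg mh mq mqc q1 _ _ gh).
  - by move=> x; rewrite qc invrK addrC subrK.
  - by rewrite divr_ge0// mulr_ge0// ltW.
  - apply: le_trans Il; apply: le_integralT => x.
      by rewrite lee_fin powR_ge0.
    rewrite indicE; have [/set_mem Bx|_] := boolP (x \in B); last first.
      by rewrite mulr0 powR0 ?gt_eqF//; exact: poweR_ge0.
    rewrite mulr1 -poweR_EFin; have G0 : (0 <= `|G x| / l%:E)%E.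
      by rewrite mule_ge0// inve_ge0 lee_fin ltW.
    apply: gt0_ler_poweR; rewrite ?in_itv/= ?leey ?andbT//; first exact: ltW.
      by rewrite lee_fin mulr_ge0.
    rewrite inver gt_eqF// lee_pdivlMr// -EFinM; apply: le_trans (kG x Bx).
    by rewrite lee_fin /g mulrAC divfK// gt_eqF.
  - apply: le_trans Iv; apply: le_integralT => x.
      by rewrite lee_fin powR_ge0.
    rewrite indicE; case: (x \in B); last first.
      by rewrite mulr0 powR0 ?gt_eqF//; exact: poweR_ge0.
    by rewrite mulr1 mule1 invrK inver gt_eqF// -EFinM poweR_EFin mulrC.
rewrite muB -EFinM lee_fin mulrAC ler_pdivrMr ?mulr_gt0//.
by rewrite mulrA.
Qed.

(** With [a] the average of [f], this makes the numerator in the sharp maximal function a real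
    number. *)
Lemma integral_oscillation_fin (f : T -> R) (B : set T) (a : R) :
  measurable B -> (mu B < +oo)%E -> measurable_fun [set: T] f ->
  mu.-integrable B (EFin \o f) ->
  (\int[mu]_(y in B) `|f y - a|%:E < +oo)%E.
Proof.
move=> mB Boo mf /integrableP[mfB fB].
have mfB' : measurable_fun B f by exact: measurable_funTS.
apply: (@le_lt_trans _ _ (\int[mu]_(y in B) (`|f y|%:E + `|a|%:E))%E).
  apply: ge0_le_integral => //.
  - apply/measurable_EFinP; apply: measurableT_comp => //.
    exact: measurable_funB.
  - apply: emeasurable_funD => //.
    by apply/measurable_EFinP; exact: measurableT_comp.
  - by move=> y _; rewrite -EFinD lee_fin ler_normB.
rewrite ge0_integralD//; last first.
  by apply/measurable_EFinP; exact: measurableT_comp.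
rewrite lte_add_pinfty// integral_cst//.
by rewrite lte_mul_pinfty.
Qed.

End weighted_luxemburg_duality.

(** * The weighted estimate on a single ball *)

Section sharp_maximal_bound.
Local Open Scope classical_set_scope.
Variables (R : realType) (n : nat).
Local Notation Rn := (Rn R n).
Local Notation mu := (@leb R n).

(** The unit ball about [x] contributes a nonnegative member, so the supremum is not that of an
    empty set. *)
Lemma sharp_maximal_ge0 (beta : R) (q f : Rn -> R) (x : Rn) :
  (0 <= sharp_maximal beta q f x)%E.
Proof.
have xx : eball x 1 x.
  rewrite /eball/= /enorm_diff big1 ?sqrtr0// => i _.
  by rewrite subrr expr0n.
have : [set e | exists c (r : R), let B := eball c r in
    [/\ (0 < r)%R, B x &
        e = (\int[mu]_(y in B) `|f y - average B f|%:E) /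
            (mu B `^ beta^-1 * vnorm (conj_exp q) (chi B))]]%E
   ((\int[mu]_(y in eball x 1) `|f y - average (eball x 1) f|%:E) /
            (mu (eball x 1) `^ beta^-1 *
             vnorm (conj_exp q) (chi (eball x 1))))%E.
  by exists x, 1.
move=> /ereal_sup_ubound; apply: le_trans.
rewrite mule_ge0//; first by apply: integral_ge0 => y _; rewrite lee_fin.
rewrite inve_ge0 mule_ge0 ?poweR_ge0//.
by apply: le_ereal_inf_tmp => _ [l [l0 _] <-]; rewrite lee_fin ltW.
Qed.

Lemma sharp_maximal_weight_le (beta : R) (p s q w f : Rn -> R)
    (c x : Rn) (r V xs xq xp K C0 l : R) :
  (0 < n)%N ->
  measurable_fun [set: Rn] q -> (forall x, 1 < q x) ->
  measurable_fun [set: Rn] w -> measurable_fun [set: Rn] (fun x => (w x)^-1) ->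
  {ae mu, forall x, 0 < w x} ->
  locally_integrable_n f -> 0 < r -> eball c r x -> 0 < w x ->
  0 < V -> mu (eball c r) = V%:E ->
  0 < xs -> 0 < xp -> 0 < xq -> xs * xq <= K * V * xp ->
  vnorm (conj_exp s) (chi (eball c r)) = xs%:E ->
  vnorm (conj_exp q) (chi (eball c r)) = xq%:E ->
  vnorm (conj_exp p) (chi (eball c r)) = xp%:E ->
  (Lnorm mu +oo (fun x => ((w x)^-1)%:E * chi (eball c r) x) *
      vnorm (conj_exp q) (fun x => ((w x)^-1)^-1%:E * chi (eball c r) x)
    <= C0%:E * vnorm (conj_exp q) (chi (eball c r)))%E ->
  (`|(w x)^-1|%:E <=
    Lnorm mu +oo (fun y => ((w y)^-1)%:E * chi (eball c r) y))%E ->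
  0 < C0 -> 0 < l ->
  (\int[mu]_x (`|sharp_maximal beta s f x * (w x)^-1%:E| / l%:E) `^ (q x)
    <= 1)%E ->
  ((\int[mu]_(y in eball c r) `|f y - average (eball c r) f|%:E) /
    (mu (eball c r) `^ beta^-1 * vnorm (conj_exp p) (chi (eball c r)))
   <= (2 * C0 * K * l * w x)%:E)%E.
Proof.
move=> n0 mq q1 mw mwV w0 fl r0 xB wx V0 muB xs0 xp0 xq0 xK Es Eq Ep Aw wL C00 l0 Il.
have mB := measurable_eball c r.
have Boo := leb_eball_fin c r0.
have [mf fi] := fl.
have := integral_oscillation_fin (average (eball c r) f) mB Boo mf (fi c r).
have : (0 <= \int[mu]_(y in eball c r) `|f y - average (eball c r) f|%:E)%E.
  by apply: integral_ge0 => y _; rewrite lee_fin.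
case Eo : (integral _ _ _) => [a| |]//; rewrite lee_fin => a0 _.
pose D := V `^ beta^-1; have D0 : 0 < D by rewrite powR_gt0.
pose k := a / (D * xs).
have k0 : 0 <= k by rewrite divr_ge0// mulr_ge0// ltW.
have divE y : 0 < y -> (a%:E / (V%:E `^ beta^-1 * y%:E) = (a / (D * y))%:E)%E.
  by move=> y0; rewrite poweR_EFin -EFinM inver gt_eqF ?mulr_gt0.
(* At every point of the ball, [k] is one of the numbers whose supremum is the sharp maximal
   function with exponent [s]. *)
have kG y : eball c r y ->
    ((k * `|(w y)^-1|)%:E <= `|sharp_maximal beta s f y * (w y)^-1%:E|)%E.
  move=> yB; rewrite abseM EFinM; apply: lee_wpmul2r => //.
  apply: le_trans (lee_abs _); apply: ereal_sup_ubound; exists c, r => /=.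
  by split => //; rewrite Eo muB Es divE.
have dual v : 0 < v ->
    (\int[mu]_x (`|((w x)^-1)^-1%:E * chi (eball c r) x| / v%:E)
       `^ (conj_exp q x) <= 1)%E -> k * V <= 2 * l * v.
  move=> v0; apply: (luxemburg_duality mq q1 _ mw mwV w0 mB muB k0 kG l0 Il v0).
  by move=> y; exact: conj_expE.
(* The bound holds for every admissible v, hence for the infimum, which is +oo if there is none. *)
have Wge : ((k * V / (2 * l))%:E <=
    vnorm (conj_exp q) (fun x => ((w x)^-1)^-1%:E * chi (eball c r) x))%E.
  apply: le_ereal_inf_tmp => _ [v [v0 Iv] <-]; rewrite lee_fin.
  by rewrite ler_pdivrMr ?mulr_gt0// [leRHS]mulrC; exact: dual.
have H : (w x)^-1 * (k * V / (2 * l)) <= C0 * xq.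
  rewrite -lee_fin [leRHS]EFinM -Eq; apply: le_trans Aw; rewrite EFinM.
  apply: lee_pmul => //.
  - by rewrite lee_fin invr_ge0 ltW.
  - by rewrite lee_fin; apply: divr_ge0; rewrite mulr_ge0// ltW.
  - by apply: le_trans wL; rewrite lee_fin ler_norm.
rewrite muB Ep divE// lee_fin.
have -> : a / (D * xp) = k * xs / xp.
  by rewrite /k; field; rewrite !gt_eqF.
rewrite ler_pdivrMr//.
have {}H : k * V <= 2 * l * C0 * xq * w x.
  move: H; rewrite mulrC ler_pdivrMr// ler_pdivrMr ?mulr_gt0//.
  by rewrite (_ : C0 * xq * w x * (2 * l) = 2 * l * C0 * xq * w x)//; ring.
(* The factor [V] makes k V appear and lets xs xq <= K V xp be applied. *)
rewrite -(ler_pM2r V0).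
apply: (@le_trans _ _ (2 * l * C0 * w x * (xs * xq))).
  rewrite (_ : k * xs * V = k * V * xs); last by ring.
  rewrite (_ : _ * (xs * xq) = 2 * l * C0 * xq * w x * xs); last by ring.
  by rewrite ler_pM2r.
rewrite (_ : _ * V = 2 * l * C0 * w x * (K * V * xp)); last by ring.
by rewrite ler_pM2l// !mulr_gt0.
Qed.

End sharp_maximal_bound.

(** * Comparison of the two sharp maximal functions *)

Theorem proposition2p10 (R : realType) (n : nat) (n_gt0 : (0 < n)%N)
    (beta : R) (beta_gt1 : 1 < beta)
    (delta tdelta s p w : Rn R n -> R)
    (delta_bounds : forall x, 0 <= tdelta x < delta x /\ delta x < 1)
    (sE : forall x, delta x / n%:R = 1 / beta - 1 / s x)
    (pE : forall x, tdelta x / n%:R = 1 / beta - 1 / p x)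
    (sP : exponent_Plog s) (pP : exponent_Plog p)
    (w_weight : weight w)
    (wA : A_infty (fun x => n%:R / (delta x - tdelta x)) (fun x => (w x)^-1)) :
  exists2 C : R, 0 < C & forall f : Rn R n -> R, locally_integrable_n f ->
    (Lnorm (@leb R n) +oo (fun x => sharp_maximal beta p f x * (w x)^-1%:E)
     <= C%:E * vnorm (fun x => (n%:R / (delta x - tdelta x))%R)
                 (fun x => sharp_maximal beta s f x * (w x)^-1%:E))%E.
Proof.
have nR0 : 0 < n%:R :> R by rewrite ltr0n.
have n1 : 1 <= n%:R :> R by rewrite ler1n.
have [[ms s1 _ _] sH] := sP; have [[mp p1 _ _] pH] := pP.
have [[mw _] w0] := w_weight.
have [[[mwV _] _] [C0 C00 HA]] := wA.
set q := fun x => n%:R / (delta x - tdelta x) in HA *.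
have q1 x : 1 < q x.
  have [/andP[? ?] ?] := delta_bounds x.
  by rewrite /q ltr_pdivlMr; lra.
have bp x : beta <= p x.
  have [/andP[t0 _] _] := delta_bounds x.
  have : 0 <= 1 / beta - 1 / p x by rewrite -pE divr_ge0// ltW.
  by rewrite !div1r subr_ge0 lef_pV2 ?posrE//; have := p1 x; lra.
have bs x : beta <= s x.
  have [/andP[t0 td] _] := delta_bounds x.
  have : 0 <= 1 / beta - 1 / s x by rewrite -sE divr_ge0//; lra.
  by rewrite !div1r subr_ge0 lef_pV2 ?posrE//; have := s1 x; lra.
have qE x : (q x)^-1 = (p x)^-1 - (s x)^-1.
  rewrite /q invf_div mulrBl sE pE; ring.
(* Measurability of [q] is inherited from [p] and [s] through 1/q = 1/p - 1/s. *)
have mq : measurable_fun setT q.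
  rewrite (_ : q = fun x => ((p x)^-1 - (s x)^-1)^-1); last first.
    by apply/funext => x; rewrite -qE invrK.
  apply: measurable_fun_inv_ge0.
    by move=> x; rewrite -qE invr_ge0; apply/ltW/(lt_trans ltr01).
  apply: measurable_funB; apply: measurable_fun_inv_ge0 => // x.
    by have := p1 x; lra.
  by have := s1 x; lra.
have [K K0 HK] := vnorm_chi_eball_mul n_gt0 beta_gt1 bp bs q1 qE pH sH.
have C'0 : 0 < 2 * C0 * K by rewrite !mulr_gt0.
exists (2 * C0 * K) => // f fl.
(* It suffices to bound the left side by C l for each admissible l; this includes the case of an
   infinite norm. *)
rewrite -lee_pdivrMl//; apply: le_ereal_inf_tmp => _ [l [l0 Il] <-].
rewrite lee_pdivrMl// -EFinM LnormyE//; apply/ess_supP.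
have ae_inv := ae_le_Lnormy_eball (fun x => (w x)^-1) n_gt0.
(* Both null sets are independent of the ball, so at each remaining [x] the supremum over balls can
   be bounded member by member. *)
apply: filterS2 w0 ae_inv => x wx winv.
rewrite abseM !gee0_abs ?sharp_maximal_ge0 ?lee_fin ?invr_ge0 ?(ltW wx)//.
rewrite lee_pdivrMr// -EFinM; apply: ge_ereal_sup => _ [c [r [r0 xB ->]]].
have [V [xs [xq [xp [V0 muB [[xs0 xp0 xq0 xK] [Es Eq Ep]]]]]]] := HK c r r0.
by apply: (sharp_maximal_weight_le n_gt0 mq q1 mw mwV w_weight.2 fl r0 xB wx
  V0 muB xs0 xp0 xq0 xK Es Eq Ep (HA c r r0) (winv c r xB) C00 l0 Il).
Qed.
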